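(* The continued fraction \[ 2+\cfrac{-16\cdot 1^6}{36+\cfrac{-16\cdot 2^6}{160+\cfrac{-16\cdot 3^6}{434+\ddots}}} \] with partial denominators $a_n=(2n+1)(5n^2+5n+2)$ ($n\ge 0$) and partial numerators $b_n=-16n^6$ ($n\ge 1$) converges, and its value is \[ \frac{12}{7\zeta(3)}. \] Equivalently, $\operatorname{PCF}\bigl((2n+1)(5n^2+5n+2),-16n^6\bigr)=\dfrac{12}{7\zeta(3)}$.
   Context: $\zeta$ denotes the Riemann zeta function. For sequences $a_n,b_n$, $\operatorname{PCF}(a_n,b_n)$ denotes the continued fraction $a_0+\cfrac{b_1}{a_1+\cfrac{b_2}{a_2+\ddots}}$. Its convergents are $P_n/Q_n$, where $P_{-1}=1$, $P_0=a_0$, $Q_{-1}=0$, $Q_0=1$, and $U_n=a_nU_{n-1}+b_nU_{n-2}$ for $n\ge 1$ with $U=P$ or $U=Q$. The continued fraction converges to a value $v$ if $P_n/Q_n\to v$ as $n\to\infty$. *)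

(* Defs.v *)
From Stdlib Require Import Reals.
From Coquelicot Require Import Coquelicot.
Open Scope R_scope.

(* The Dirichlet series sum_{k >= 1} k^(-s).  It is the Riemann zeta function
   for real s > 1; for s <= 1 the series diverges and the value is junk. *)
Definition zeta (s : R) : R := Series (fun k => / Rpower (INR (S k)) s).

(* Solution of U_n = a_n U_{n-1} + b_n U_{n-2} (n >= 1) with U_{-1} = um1 and
   U_0 = u0; the inner match handles the index n - 2 = -1 at n = 1.
   The value b 0 is never used. *)
Fixpoint cf_rec (a b : nat -> R) (um1 u0 : R) (n : nat) : R :=
  match n with
  | O => u0
  | S m =>
      a (S m) * cf_rec a b um1 u0 m +
      b (S m) * match m with
                | O => um1
                | S k => cf_rec a b um1 u0 k
                end
  end.

Definition cf_num (a b : nat -> R) : nat -> R := cf_rec a b 1 (a 0%nat).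
Definition cf_den (a b : nat -> R) : nat -> R := cf_rec a b 0 1.

(* Division is total, so we require that all but finitely many convergents
   are genuine quotients. *)
Definition is_pcf (a b : nat -> R) (v : R) : Prop :=
  eventually (fun n => cf_den a b n <> 0) /\
  is_lim_seq (fun n => cf_num a b n / cf_den a b n) (Finite v).

(* Main.v *)
(** The value comes from the series
    [T n = sum_i n!^2 4^n (i+1)_n / (i+1/2)_{n+1}^3].
    Each [T n] satisfies, up to normalisation, the recurrence of the continued
    fraction (a Wilf-Zeilberger telescoping in [i]), and
    [T 0 = sum_i 1/(i+1/2)^3 = 7 zeta(3)].  Hence, with [Z = 7 zeta(3) / 12],
    [Z P_n - Q_n = (n+1)!^3 T (n+1) / (12 * 2^(n+1))].
    As [T n <= 4^n T 0] while [P_n / (n+1)!^3] grows at least like [4^n],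
    the quotient [Q_n / P_n] tends to [Z]. *)

Require Import Defs.
From Stdlib Require Import Reals Factorial Lra Lia.
From Coquelicot Require Import Coquelicot.
Open Scope R_scope.

(** * Series tools: telescoping, comparison, even-odd splitting *)

Lemma is_series_telescope (G : nat -> R) (l : R) :
  is_lim_seq G l -> is_series (fun i => G (S i) - G i) (l - G 0%nat).
Proof.
  intros HG.
  assert (H : is_lim_seq (sum_n (fun i => G (S i) - G i)) (l - G 0%nat)).
  { apply is_lim_seq_ext with (fun n => G (S n) - G 0%nat).
    - intros n; induction n as [|n IH].
      + now rewrite sum_O.
      + rewrite sum_Sn, <- IH; unfold plus; simpl; ring.
    - apply is_lim_seq_minus'; [now apply -> is_lim_seq_incr_1 | apply is_lim_seq_const]. }
  exact H.
Qed.

Lemma is_lim_seq_const_div_succ (C : R) : is_lim_seq (fun n => C / (INR n + 1)) 0.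
Proof.
  replace (Finite 0) with (Rbar_mult C 0) by (simpl; f_equal; ring).
  apply is_lim_seq_scal_l.
  apply is_lim_seq_ext with (fun n => / INR (S n)).
  - intros n; now rewrite S_INR.
  - apply -> (is_lim_seq_incr_1 (fun n => / INR n)).
    replace (Finite 0) with (Rbar_inv p_infty) by reflexivity.
    apply is_lim_seq_inv; [apply is_lim_seq_INR | discriminate].
Qed.

(** Comparison with the telescoping series of [2 / ((k + 1) * (k + 2))]. *)
Lemma ex_series_inv_cube : ex_series (fun k => / (INR k + 1) ^ 3).
Proof.
  apply (@ex_series_le R_AbsRing R_CompleteNormedModule)
    with (fun k => - (2) / (INR (S k) + 1) - - (2) / (INR k + 1)).
  - intros k; change norm with Rabs; pose proof (pos_INR k) as Hk.
    rewrite S_INR, Rabs_pos_eq.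
    + replace (- (2) / (INR k + 1 + 1) - - (2) / (INR k + 1))
        with (/ ((INR k + 1) * (INR k + 2) / 2)) by (field; lra).
      apply Rinv_le_contravar; nra.
    + apply Rlt_le, Rinv_0_lt_compat, pow_lt; lra.
  - eexists; apply (is_series_telescope (fun k => - (2) / (INR k + 1)) 0).
    apply is_lim_seq_const_div_succ.
Qed.

Lemma is_series_ext_R (f g : nat -> R) (l : R) :
  (forall i, f i = g i) -> is_series f l -> is_series g l.
Proof. apply is_series_ext. Qed.

Lemma is_series_mult_l (c l : R) (f : nat -> R) :
  is_series f l -> is_series (fun i => c * f i) (c * l).
Proof. exact (is_series_scal c f l). Qed.

Lemma ex_series_mult_l (c : R) (f : nat -> R) :
  ex_series f -> ex_series (fun i => c * f i).
Proof. intros [l Hl]; exists (c * l); now apply is_series_mult_l. Qed.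

(** The partial sum up to the odd index [2 * n + 1] splits exactly into two partial sums of length
    [n + 1]; as a subsequence it still tends to [l]. *)
Lemma is_series_even_odd (f : nat -> R) (l a b : R) :
  is_series f l ->
  is_series (fun i => f (2 * i)%nat) a ->
  is_series (fun i => f (2 * i + 1)%nat) b ->
  l = a + b.
Proof.
  intros Hf Ha Hb.
  assert (Hsum : forall n, sum_n f (2 * n + 1) =
     sum_n (fun i => f (2 * i)%nat) n + sum_n (fun i => f (2 * i + 1)%nat) n).
  { intros n; induction n as [|n IH].
    - change (2 * 0 + 1)%nat with 1%nat; now rewrite sum_Sn, !sum_O.
    - replace (2 * S n + 1)%nat with (S (S (2 * n + 1))) by lia.
      rewrite !sum_Sn, IH; unfold plus; simpl AbelianMonoid.sort.
      replace (2 * S n + 1)%nat with (S (S (2 * n + 1))) by lia.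
      replace (2 * S n)%nat with (S (2 * n + 1)) by lia.
      simpl; ring. }
  assert (H1 : is_lim_seq (fun n => sum_n f (2 * n + 1)) l).
  { apply (is_lim_seq_subseq (sum_n f) l (fun n => (2 * n + 1)%nat)); [|exact Hf].
    apply eventually_subseq; intros n; lia. }
  assert (H2 : is_lim_seq (fun n => sum_n f (2 * n + 1)) (a + b)).
  { apply is_lim_seq_ext with (1 := fun n => eq_sym (Hsum n)).
    now apply is_lim_seq_plus'. }
  apply is_lim_seq_unique in H1; apply is_lim_seq_unique in H2.
  rewrite H1 in H2; now injection H2.
Qed.

Lemma zeta_3_eq : zeta 3 = Series (fun k => / (INR k + 1) ^ 3).
Proof.
  unfold zeta; apply Series_ext; intros k.
  replace 3 with (INR 3) by (simpl; ring).
  rewrite Rpower_pow, S_INR; [reflexivity | apply lt_0_INR; lia].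
Qed.

(** * The summands [t n i], their ratios and bounds *)

(** The hypergeometric summand of [T n], encoded by its ratio in [n], so that no Pochhammer symbols
    are needed and identities between shifts reduce to [field]. *)
Fixpoint t (n i : nat) : R :=
  match n with
  | O => / (INR i + / 2) ^ 3
  | S m => t m i * (4 * INR n ^ 2 * (INR i + INR n) / (INR i + INR n + / 2) ^ 3)
  end.

Definition T (n : nat) : R := Series (t n).

Lemma t_S (n i : nat) :
  t (S n) i = t n i * (4 * (INR n + 1) ^ 2 * (INR i + INR n + 1) / (INR i + INR n + 3 / 2) ^ 3).
Proof.
  cbn [t]; rewrite S_INR.
  pose proof (pos_INR n); pose proof (pos_INR i).
  field; lra.
Qed.

(** The ratio in [i], which the recursion on [n] does not give directly; the telescoping identities
    in [i] rest on it. *)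
Lemma t_shift (n i : nat) :
  t n (S i) = t n i * ((INR i + INR n + 1) / (INR i + 1)
                       * ((INR i + / 2) / (INR i + INR n + 3 / 2)) ^ 3).
Proof.
  pose proof (pos_INR i) as Hi.
  induction n as [|n IH].
  - cbn [t]; rewrite S_INR; change (INR 0) with 0; field; lra.
  - pose proof (pos_INR n) as Hn.
    rewrite !t_S, IH, !S_INR; field; lra.
Qed.

Lemma t_pos (n i : nat) : 0 < t n i.
Proof.
  pose proof (pos_INR i) as Hi.
  induction n as [|n IH].
  - cbn [t]; apply Rinv_0_lt_compat, pow_lt; lra.
  - pose proof (pos_INR n) as Hn; rewrite t_S.
    apply Rmult_lt_0_compat; [exact IH|].
    apply Rdiv_lt_0_compat; [|apply pow_lt; lra].
    apply Rmult_lt_0_compat; [|lra].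
    apply Rmult_lt_0_compat; [lra | apply pow_lt; lra].
Qed.

(** Each ratio in [n] is at most 4, since [n + 1] and [i + n + 1] are both below [i + n + 3/2]. *)
Lemma t_le (n i : nat) : t n i <= 4 ^ n * t 0 i.
Proof.
  pose proof (pos_INR i) as Hi.
  induction n as [|n IH].
  - simpl; lra.
  - pose proof (pos_INR n) as Hn; pose proof (t_pos n i) as Ht.
    rewrite t_S; change (4 ^ S n) with (4 * 4 ^ n).
    assert (Hr : 4 * (INR n + 1) ^ 2 * (INR i + INR n + 1) / (INR i + INR n + 3 / 2) ^ 3 <= 4).
    { apply Rle_div_l; [apply pow_lt; lra|].
      assert (H1 : (INR n + 1) ^ 2 <= (INR i + INR n + 3 / 2) ^ 2) by (apply pow_incr; lra).
      pose proof (pow2_ge_0 (INR i + INR n + 3 / 2)).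
      simpl in *; nra. }
    nra.
Qed.

Lemma t_0_le (i : nat) : t 0 i <= 8 * / (INR i + 1) ^ 3.
Proof.
  pose proof (pos_INR i) as Hi; cbn [t].
  replace (8 * / (INR i + 1) ^ 3) with (/ ((INR i + 1) / 2) ^ 3) by (field; lra).
  apply Rinv_le_contravar; [apply pow_lt | apply pow_incr]; lra.
Qed.

Lemma ex_series_t (n : nat) : ex_series (t n).
Proof.
  apply (@ex_series_le R_AbsRing R_CompleteNormedModule)
    with (fun i => 4 ^ n * (8 * / (INR i + 1) ^ 3)).
  - intros i; change norm with Rabs.
    rewrite Rabs_pos_eq; [|apply Rlt_le, t_pos].
    apply Rle_trans with (1 := t_le n i).
    apply Rmult_le_compat_l; [apply pow_le; lra | apply t_0_le].
  - apply ex_series_mult_l, ex_series_mult_l, ex_series_inv_cube.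
Qed.

(** Odd integers [2 * (i + 1/2)] contribute [T 0 / 8] to [zeta 3], and even integers [2 * (i + 1)]
    contribute [zeta 3 / 8]. *)
Lemma T_0_eq : T 0 = 7 * zeta 3.
Proof.
  rewrite zeta_3_eq.
  set (z := Series _).
  assert (Hz : is_series (fun k => / (INR k + 1) ^ 3) z)
    by apply Series_correct, ex_series_inv_cube.
  assert (H : z = / 8 * T 0 + / 8 * z).
  { apply is_series_even_odd with (1 := Hz).
    - apply is_series_ext_R with (fun i => / 8 * t 0 i).
      + intros i; pose proof (pos_INR i); cbn [t].
        rewrite mult_INR; simpl (INR 2); field; lra.
      + apply is_series_mult_l, Series_correct, ex_series_t.
    - apply is_series_ext_R with (fun i => / 8 * / (INR i + 1) ^ 3).
      + intros i; pose proof (pos_INR i).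
        rewrite plus_INR, mult_INR; simpl (INR 2); simpl (INR 1); field; lra.
      + now apply is_series_mult_l. }
  lra.
Qed.

Lemma T_pos (n : nat) : 0 < T n.
Proof.
  unfold T; rewrite Series_incr_1 by apply ex_series_t.
  apply Rplus_lt_le_0_compat; [apply t_pos|].
  rewrite <- (Rmult_0_l (Series (fun k => t n (S k)))), <- Series_scal_l.
  apply Series_le.
  - intros k; pose proof (t_pos n (S k)); lra.
  - apply (ex_series_incr_1 (t n)), ex_series_t.
Qed.

Lemma T_le (n : nat) : T n <= 4 ^ n * T 0.
Proof.
  unfold T; rewrite <- Series_scal_l.
  apply Series_le.
  - intros k; split; [apply Rlt_le, t_pos | apply t_le].
  - apply ex_series_mult_l, ex_series_t.
Qed.

(** * The recurrence for [T] by creative telescoping *)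

(** The second initial value. It is the case [n = 0] of the recurrence, except that the boundary
    term [G 0 = 24] does not vanish. *)
Lemma T_1_eq : T 1 = 4 * T 0 - 24.
Proof.
  set (G := fun i : nat => (2 * INR i + 3) / (INR i + / 2) ^ 3).
  assert (HG : is_lim_seq G 0).
  (* The constant 24 gives equality at [i = 0]. *)
  { apply is_lim_seq_le_le with (fun _ => 0) (fun i => 24 / (INR i + 1)).
    - intros i; pose proof (pos_INR i) as Hi; unfold G; split.
      + apply Rlt_le, Rdiv_lt_0_compat; [lra | apply pow_lt; lra].
      + apply Rle_div_l; [apply pow_lt; lra|].
        replace (24 / (INR i + 1) * (INR i + / 2) ^ 3)
          with (24 * (INR i + / 2) ^ 3 / (INR i + 1)) by (field; lra).
        apply Rle_div_r; [lra|].
        simpl; nra.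
    - apply is_lim_seq_const.
    - apply is_lim_seq_const_div_succ. }
  assert (H : is_series (fun i => t 1 i - 4 * t 0 i) (T 1 - 4 * T 0)).
  { apply (is_series_minus (t 1) (fun i => 4 * t 0 i)).
    - apply Series_correct, ex_series_t.
    - apply is_series_mult_l, Series_correct, ex_series_t. }
  assert (H' : is_series (fun i => t 1 i - 4 * t 0 i) (0 - G 0%nat)).
  { apply is_series_ext_R with (fun i => G (S i) - G i).
    - intros i; pose proof (pos_INR i); rewrite t_S; unfold G; cbn [t].
      rewrite S_INR; change (INR 0) with 0; field; lra.
    - now apply is_series_telescope. }
  apply is_series_unique in H; apply is_series_unique in H'.
  rewrite H in H'; unfold G in H'; change (INR 0) with 0 in H'.
  replace (0 - (2 * 0 + 3) / (0 + / 2) ^ 3) with (- (24)) in H' by field.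
  lra.
Qed.

(* Certificate found by solving, for small [n], the linear system for a
   numerator of degree 4 in [i], then interpolating in [n]. *)
Definition G_cert (m i : nat) : R :=
  let n := INR m + 1 in let x := INR i in
  - (n ^ 2 * x * (32 * x ^ 3 + 48 * (1 + 3 * n) * x ^ 2 + (16 + 152 * n + 208 * n ^ 2) * x
                + (- (8) + 16 * n + 104 * n ^ 2 + 96 * n ^ 3))
     / (x + n + / 2) ^ 3) * t m i.

(** By the two ratio lemmas every term is a rational function times [t m i], so this is an identity
    of rational functions. *)
Lemma t_rec (m i : nat) :
  let n := INR m + 1 in
  (n + 1) ^ 3 * t (S (S m)) i - 2 * (2 * n + 1) * (5 * n ^ 2 + 5 * n + 2) * t (S m) i
  + 64 * n ^ 3 * t m i = G_cert m (S i) - G_cert m i.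
Proof.
  cbv zeta; unfold G_cert; cbv zeta.
  pose proof (pos_INR m) as Hm; pose proof (pos_INR i) as Hi.
  rewrite t_shift, !t_S, !S_INR.
  field; lra.
Qed.

(** The certificate is [i * t m i] times a bounded rational function, and [t m i] decays at least
    like the inverse cube of [i]. *)
Lemma G_cert_lim (m : nat) : is_lim_seq (G_cert m) 0.
Proof.
  pose proof (pos_INR m) as Hm.
  set (n := INR m + 1).
  (* [K] is the sum of the coefficients of the cubic in [x]; each power of [x] up to the third is at
     most [(x + n + / 2) ^ 3], whose base exceeds 1. *)
  set (K := 32 + 48 * (1 + 3 * n) + (16 + 152 * n + 208 * n ^ 2)
            + (- (8) + 16 * n + 104 * n ^ 2 + 96 * n ^ 3)).
  (* The factor [4 ^ m * 8] comes from [t_le] and [t_0_le]. *)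
  set (C := - (n ^ 2 * K * (4 ^ m * 8))).
  apply is_lim_seq_le_le with (fun i => C / (INR i + 1)) (fun _ => 0).
  - intros i; pose proof (pos_INR i) as Hi.
    unfold G_cert; cbv zeta; fold n; set (x := INR i) in *.
    set (p := 32 * x ^ 3 + _ + _ + _).
    assert (Hn : 1 <= n) by (unfold n; lra).
    assert (Hn2 : 1 <= n ^ 2) by (apply pow_R1_Rle; lra).
    assert (Hn3 : 1 <= n ^ 3) by (apply pow_R1_Rle; lra).
    assert (Hy : 0 < (x + n + / 2) ^ 3) by (apply pow_lt; lra).
    assert (Hp : 0 <= p <= K * (x + n + / 2) ^ 3).
    { assert (Hx2 : 0 <= x ^ 2) by (apply pow_le; lra).
      assert (Hx3 : 0 <= x ^ 3) by (apply pow_le; lra).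
      assert (H3 : x ^ 3 <= (x + n + / 2) ^ 3) by (apply pow_incr; lra).
      assert (H2 : x ^ 2 <= (x + n + / 2) ^ 3)
        by (apply Rle_trans with ((x + n + / 2) ^ 2);
            [apply pow_incr | apply Rle_pow; [|lia]]; lra).
      assert (H1 : x <= (x + n + / 2) ^ 3)
        by (apply Rle_trans with ((x + n + / 2) ^ 1);
            [lra | apply Rle_pow; [lra | lia]]).
      assert (H0 : 1 <= (x + n + / 2) ^ 3) by (apply pow_R1_Rle; lra).
      assert (Hc2 : 0 <= 48 * (1 + 3 * n)) by lra.
      assert (Hc1 : 0 <= 16 + 152 * n + 208 * n ^ 2) by lra.
      assert (Hc0 : 0 <= - (8) + 16 * n + 104 * n ^ 2 + 96 * n ^ 3) by lra.
      unfold p, K.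
      set (c2 := 48 * _) in *; set (c1 := 16 + _ + _) in *; set (c0 := - (8) + _ + _ + _) in *.
      assert (Hm2 := Rmult_le_compat_l _ _ _ Hc2 H2).
      assert (Hm1 := Rmult_le_compat_l _ _ _ Hc1 H1).
      assert (Hm0 := Rmult_le_compat_l _ _ _ Hc0 H0).
      assert (Hp2 := Rmult_le_pos _ _ Hc2 Hx2).
      assert (Hp1 := Rmult_le_pos _ _ Hc1 Hi).
      split; lra. }
    assert (Hq : 0 <= p / (x + n + / 2) ^ 3 <= K).
    { split.
      - apply Rdiv_le_0_compat; lra.
      - now apply Rle_div_l. }
    assert (Ht : x * t m i <= 4 ^ m * 8 / (x + 1)).
    { apply Rle_trans with (x * (4 ^ m * (8 * / (x + 1) ^ 3))).
      - apply Rmult_le_compat_l; [lra|].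
        apply Rle_trans with (1 := t_le m i).
        apply Rmult_le_compat_l; [apply pow_le; lra | apply t_0_le].
      - replace (x * (4 ^ m * (8 * / (x + 1) ^ 3)))
          with (4 ^ m * 8 / (x + 1) * (x / (x + 1) ^ 2)) by (field; lra).
        rewrite <- (Rmult_1_r (4 ^ m * 8 / (x + 1))) at 2.
        apply Rmult_le_compat_l.
        + apply Rdiv_le_0_compat; [|lra].
          apply Rmult_le_pos; [apply pow_le|]; lra.
        + apply Rle_div_l; [apply pow_lt; lra | nra]. }
    pose proof (t_pos m i) as Htp.
    assert (Hxt : 0 <= x * t m i) by (apply Rmult_le_pos; lra).
    replace (- (n ^ 2 * x * p / (x + n + / 2) ^ 3) * t m i)
      with (- (n ^ 2 * ((p / (x + n + / 2) ^ 3) * (x * t m i)))) by (field; lra).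
    replace (C / (x + 1)) with (- (n ^ 2 * (K * (4 ^ m * 8 / (x + 1)))))
      by (unfold C; field; lra).
    split.
    + apply Ropp_le_contravar, Rmult_le_compat_l; [lra|].
      apply Rmult_le_compat; tauto.
    + rewrite <- Ropp_0; apply Ropp_le_contravar.
      apply Rmult_le_pos; [lra|].
      apply Rmult_le_pos; tauto.
  - apply is_lim_seq_const_div_succ.
  - apply is_lim_seq_const.
Qed.

(** Summing [t_rec] over [i] leaves only boundary terms: the certificate vanishes at [i = 0] through
    its factor [x], and at infinity by [G_cert_lim]. *)
Lemma T_rec (m : nat) :
  let n := INR m + 1 in
  (n + 1) ^ 3 * T (S (S m))
  = 2 * (2 * n + 1) * (5 * n ^ 2 + 5 * n + 2) * T (S m) - 64 * n ^ 3 * T m.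
Proof.
  intros n.
  assert (Hs : forall c k, is_series (fun i => c * t k i) (c * T k)).
  { intros c k; apply is_series_mult_l, Series_correct, ex_series_t. }
  assert (H := is_series_plus _ _ _ _
    (is_series_minus _ _ _ _ (Hs ((n + 1) ^ 3) (S (S m)))
       (Hs (2 * (2 * n + 1) * (5 * n ^ 2 + 5 * n + 2)) (S m)))
    (Hs (64 * n ^ 3) m)).
  apply is_series_ext_R with (g := fun i => G_cert m (S i) - G_cert m i) in H.
  2: { intros i; apply (t_rec m i). }
  assert (H' := is_series_telescope _ _ (G_cert_lim m)).
  apply is_series_unique in H; apply is_series_unique in H'.
  rewrite H in H'.
  replace (G_cert m 0) with 0 in H'
    by (unfold G_cert; change (INR 0) with 0; cbv zeta; pose proof (pos_INR m); field; lra).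
  unfold plus, opp in H'; simpl AbelianMonoid.sort in H'; simpl in H'; simpl.
  lra.
Qed.

(** * The error of the convergents in terms of [T] *)

Definition a (n : nat) : R := (2 * INR n + 1) * (5 * INR n ^ 2 + 5 * INR n + 2).
Definition b (n : nat) : R := - 16 * INR n ^ 6.

Lemma nat_ind2 (P : nat -> Prop) :
  P 0%nat -> P 1%nat -> (forall n, P n -> P (S n) -> P (S (S n))) -> forall n, P n.
Proof.
  intros H0 H1 HS n; enough (P n /\ P (S n)) by tauto.
  induction n as [|n [IH1 IH2]]; auto.
Qed.

Lemma INR_fact_S (n : nat) : INR (fact (S n)) = (INR n + 1) * INR (fact n).
Proof. change (fact (S n)) with (S n * fact n)%nat; now rewrite mult_INR, S_INR. Qed.

(** Both sides solve [U_n = a_n U_{n-1} + b_n U_{n-2}] and agree at [n = 0] and [n = 1]. The cubed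
    factorial and the power of 2 turn the coefficients [2 * a n] and [64 * n ^ 3] of [T_rec] into
    [a n] and [16 * n ^ 6]. *)
Lemma cf_error (n : nat) :
  T 0 / 12 * cf_num a b n - cf_den a b n
  = INR (fact (S n)) ^ 3 * T (S n) / (12 * 2 ^ S n).
Proof.
  unfold cf_num, cf_den.
  induction n as [| |n IH1 IH2] using nat_ind2.
  - rewrite T_1_eq; unfold a; simpl; field.
  - assert (H := T_rec 0); cbv zeta in H; change (INR 0) with 0 in H.
    rewrite T_1_eq in H.
    assert (H2 : T 2 = 28 * T 0 - 216) by (simpl in H; lra).
    rewrite H2; unfold a, b; simpl; field.
  - set (x := INR n).
    assert (Hx : 0 <= x) by apply pos_INR.
    assert (Hrec : forall u v, cf_rec a b u v (S (S n))
       = a (S (S n)) * cf_rec a b u v (S n) + b (S (S n)) * cf_rec a b u v n)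
      by reflexivity.
    rewrite !Hrec.
    transitivity (a (S (S n)) * (T 0 / 12 * cf_rec a b 1 (a 0) (S n) - cf_rec a b 0 1 (S n))
      + b (S (S n)) * (T 0 / 12 * cf_rec a b 1 (a 0) n - cf_rec a b 0 1 n)); [ring|].
    rewrite IH1, IH2.
    assert (H := T_rec (S n)); cbv zeta in H.
    rewrite (INR_fact_S (S (S n))), (INR_fact_S (S n)).
    unfold a, b; rewrite !S_INR in *; fold x in H |- *.
    set (f := INR (fact (S n))).
    change (2 ^ S (S (S n))) with (2 * (2 * (2 ^ S n))).
    change (2 ^ S (S n)) with (2 * (2 ^ S n)).
    assert (Hw : 2 ^ S n <> 0) by (apply pow_nonzero; lra).
    set (w := 2 ^ S n) in *.
    (* Isolates the left side of [T_rec (S n)]; [48 * w] is [12 * 2 ^ (n + 3)]. *)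
    transitivity (f ^ 3 * (x + 2) ^ 3 * ((x + 1 + 1 + 1) ^ 3 * T (S (S (S n)))) / (48 * w)).
    + rewrite H; field; exact Hw.
    + field; exact Hw.
Qed.

(** * Growth of the numerators and convergence *)

(** After division by cubed factorials the limiting characteristic equation is
    [c^2 - 10 c + 16 = 0], with roots 2 and 8; the rate 4 between them is preserved by induction.
    The bound starts at index 1 because [P_1 = 56] is less than [4 * 2^3 * P_0 = 64]. *)
Lemma cf_num_growth (n : nat) :
  0 < cf_num a b (S n) /\
  4 * (INR n + 3) ^ 3 * cf_num a b (S n) <= cf_num a b (S (S n)).
Proof.
  unfold cf_num; induction n as [|n [Hpos IH]].
  - unfold a, b; simpl; lra.
  - set (x := INR n) in *.
    assert (Hx : 0 <= x) by apply pos_INR.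
    assert (Hx3 : 0 < (x + 3) ^ 3) by (apply pow_lt; lra).
    assert (Hpos' : 0 < cf_rec a b 1 (a 0) (S (S n))).
    { apply Rlt_le_trans with (2 := IH).
      repeat apply Rmult_lt_0_compat; lra. }
    split; [exact Hpos'|].
    change (cf_rec a b 1 (a 0) (S (S (S n)))) with
      (a (S (S (S n))) * cf_rec a b 1 (a 0) (S (S n))
       + b (S (S (S n))) * cf_rec a b 1 (a 0) (S n)).
    set (p := cf_rec a b 1 (a 0) (S (S n))) in *.
    set (q := cf_rec a b 1 (a 0) (S n)) in *.
    unfold a, b; rewrite !S_INR; fold x.
    assert (H : 16 * (x + 3) ^ 6 * q <= 4 * (x + 3) ^ 3 * p).
    { replace (16 * (x + 3) ^ 6 * q) with (4 * (x + 3) ^ 3 * (4 * (x + 3) ^ 3 * q)) by ring.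
      apply Rmult_le_compat_l; lra. }
    (* The cubic is [a (n + 3) - 4 * (n + 3) ^ 3 - 4 * (n + 4) ^ 3], the slack left once [H] absorbs
       the negative term. *)
    assert (Hpoly : 0 <= (2 * x ^ 3 + 21 * x ^ 2 + 69 * x + 70) * p).
    { apply Rmult_le_pos; [|lra].
      pose proof (pow_le x 2 Hx); pose proof (pow_le x 3 Hx); lra. }
    lra.
Qed.

Lemma cf_num_lower (n : nat) : INR (fact (S n)) ^ 3 * 4 ^ n <= cf_num a b n.
Proof.
  destruct n as [|n]; [unfold cf_num, a; simpl; lra|].
  induction n as [|n IH]; [unfold cf_num, a, b; simpl; lra|].
  destruct (cf_num_growth n) as [_ H].
  apply Rle_trans with (2 := H).
  rewrite INR_fact_S, !S_INR.
  change (4 ^ S (S n)) with (4 * 4 ^ S n).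
  assert (Hx : 0 < (INR n + 3) ^ 3) by (apply pow_lt; pose proof (pos_INR n); lra).
  replace (((INR n + 1 + 1 + 1) * INR (fact (S (S n)))) ^ 3 * (4 * 4 ^ S n))
    with (4 * (INR n + 3) ^ 3 * (INR (fact (S (S n))) ^ 3 * 4 ^ S n)) by ring.
  apply Rmult_le_compat_l; lra.
Qed.

Lemma cf_num_pos (n : nat) : 0 < cf_num a b n.
Proof.
  apply Rlt_le_trans with (2 := cf_num_lower n).
  apply Rmult_lt_0_compat; apply pow_lt; [apply INR_fact_lt_0 | lra].
Qed.

(** The inverted quotient is used because [cf_num] is known to be positive, whereas the nonvanishing
    of [cf_den] is deduced from this limit. *)
Lemma cf_inv_lim : is_lim_seq (fun n => cf_den a b n / cf_num a b n) (T 0 / 12).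
Proof.
  (* In the error over [cf_num] the factorials cancel, leaving at most [4 ^ (n + 1) * T 0 / (12 * 2
     ^ (n + 1) * 4 ^ n)]. *)
  apply is_lim_seq_le_le with (fun n => T 0 / 12 - T 0 / 6 * (/ 2) ^ n) (fun _ => T 0 / 12).
  - intros n.
    pose proof (cf_num_pos n) as HP.
    assert (HF : 0 < INR (fact (S n)) ^ 3) by apply pow_lt, INR_fact_lt_0.
    assert (H4 : 0 < 4 ^ n) by (apply pow_lt; lra).
    assert (H2 : 0 < 2 ^ n) by (apply pow_lt; lra).
    pose proof (T_pos 0) as HT0; pose proof (T_pos (S n)) as HT.
    set (e := INR (fact (S n)) ^ 3 * T (S n) / (12 * 2 ^ S n)).
    replace (cf_den a b n / cf_num a b n) with (T 0 / 12 - e / cf_num a b n)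
      by (unfold e; rewrite <- cf_error; field; lra).
    assert (He : 0 <= e / cf_num a b n <= T 0 / 6 * (/ 2) ^ n); [|lra].
    assert (H2S : 0 < 12 * 2 ^ S n) by (simpl; lra).
    split.
    + apply Rdiv_le_0_compat; [|exact HP].
      apply Rdiv_le_0_compat; [apply Rmult_le_pos; lra | exact H2S].
    + apply Rle_div_l; [exact HP|].
      apply Rle_trans with (T 0 / 6 * (/ 2) ^ n * (INR (fact (S n)) ^ 3 * 4 ^ n)).
      * replace (T 0 / 6 * (/ 2) ^ n * (INR (fact (S n)) ^ 3 * 4 ^ n))
          with (INR (fact (S n)) ^ 3 * (4 ^ S n * T 0) / (12 * 2 ^ S n))
          by (rewrite pow_inv; simpl pow at 2 3; simpl; field; lra).
        apply Rmult_le_compat_r; [apply Rlt_le, Rinv_0_lt_compat, H2S|].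
        apply Rmult_le_compat_l; [lra | apply T_le].
      * apply Rmult_le_compat_l; [|apply cf_num_lower].
        apply Rmult_le_pos; [lra | apply pow_le; lra].
  - replace (Finite (T 0 / 12)) with (Finite (T 0 / 12 - T 0 / 6 * 0)) by (f_equal; ring).
    apply is_lim_seq_minus'; [apply is_lim_seq_const|].
    apply (is_lim_seq_scal_l _ (T 0 / 6) 0).
    apply is_lim_seq_geom; rewrite Rabs_pos_eq; lra.
  - apply is_lim_seq_const.
Qed.

Theorem theorem1p3 :
  is_pcf (fun n => (2 * INR n + 1) * (5 * INR n ^ 2 + 5 * INR n + 2))
         (fun n => - 16 * INR n ^ 6)
         (12 / (7 * zeta 3)).
Proof.
  change (is_pcf a b (12 / (7 * zeta 3))).
  pose proof (T_pos 0) as HT.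
  pose proof cf_inv_lim as Hlim.
  split.
  (* A zero denominator would put the inverted quotient at distance exactly [T 0 / 12] from its
     limit, so that distance serves as epsilon. *)
  - assert (Hev := proj2 (is_lim_seq_spec _ _) Hlim).
    assert (Heps : 0 < T 0 / 12) by lra.
    destruct (Hev (mkposreal _ Heps)) as [N HN]; simpl in HN.
    exists N; intros n Hn Hden.
    specialize (HN n Hn); rewrite Hden in HN.
    replace (0 / cf_num a b n - T 0 / 12) with (- (T 0 / 12)) in HN
      by (unfold Rdiv; ring).
    rewrite Rabs_Ropp, Rabs_pos_eq in HN; lra.
  - apply is_lim_seq_ext with (fun n => / (cf_den a b n / cf_num a b n)).
    (* This holds for every [n], even where [cf_den] vanishes, because [/ 0 = 0]. *)
    + intros n; apply Rinv_div.
    + replace (Finite (12 / (7 * zeta 3))) with (Rbar_inv (T 0 / 12)).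
      * apply is_lim_seq_inv; [exact Hlim|].
        intros H; injection H; lra.
      * rewrite <- T_0_eq; simpl; f_equal; field; lra.
Qed.
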